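(* Let $P$ be the Petersen graph. Then the list strong chromatic index of $P$ is $\chi_{s,l}'(P) = 7$.
   Context: The distance between two edges of a graph $G$ is the distance between the corresponding vertices in the line graph of $G$; so two adjacent edges are at distance $1$, and two non-adjacent edges that are both adjacent to a common edge are at distance $2$. A strong edge-coloring of $G$ is an assignment of colors to the edges of $G$ in which any two distinct edges at distance at most $2$ receive distinct colors. A list assignment $L$ for $G$ assigns to each edge $e$ of $G$ a list (set) $L(e)$ of possible colors. $G$ is strong $L$-edge-colorable if it admits a strong edge-coloring $\varphi$ with $\varphi(e)\in L(e)$ for every $e\in E(G)$. $G$ is strong $k$-edge-choosable if it is strong $L$-edge-colorable for every list assignment $L$ with $|L(e)|\ge k$ for every $e\in E(G)$. The list strong chromatic index $\chi_{s,l}'(G)$ is the least $k$ such that $G$ is strong $k$-edge-choosable. *)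

(* Defs.v *)
From HB Require Import structures.
From mathcomp Require Import all_boot finmap.

Set Implicit Arguments.
Unset Strict Implicit.
Unset Printing Implicit Defensive.

Record sgraph := SGraph {
  vertex :> finType;
  adj : rel vertex;
  adj_sym : symmetric adj;
  adj_irr : irreflexive adj
}.

Section Distance.
Variable G : sgraph.

Definition walk (x y : G) (n : nat) : Prop :=
  exists p : seq G, [/\ path (@adj G) x p, last x p = y & size p = n].

(* A relation rather than a function: vertices in different components are at
   no distance. *)
Definition is_dist (x y : G) (d : nat) : Prop :=
  walk x y d /\ forall n : nat, walk x y n -> d <= n.

End Distance.

Section LineGraph.
Variable G : sgraph.

Definition edge_set : {set {set G}} :=
  [set [set p.1; p.2] | p : G * G & adj p.1 p.2].

Definition edge : finType := {f : {set G} | f \in edge_set}.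

Definition edge_adj : rel edge :=
  fun f g => (f != g) && (val f :&: val g != set0).

Lemma edge_adj_sym : symmetric edge_adj.
Proof. by move=> f g; rewrite /edge_adj eq_sym setIC. Qed.

Lemma edge_adj_irr : irreflexive edge_adj.
Proof. by move=> f; rewrite /edge_adj eqxx. Qed.

Definition line_graph : sgraph := SGraph edge_adj_sym edge_adj_irr.

End LineGraph.

Section StrongColoring.
Variable G : sgraph.

Definition strong_edge_coloring (C : Type) (phi : edge G -> C) : Prop :=
  forall (f g : edge G) (d : nat),
    f <> g -> @is_dist (line_graph G) f g d -> d <= 2 -> phi f <> phi g.

Definition strong_edge_list_colorable (C : choiceType)
    (L : edge G -> {fset C}) : Prop :=
  exists phi : edge G -> C,
    strong_edge_coloring phi /\ forall f : edge G, phi f \in L f.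

Definition strong_edge_choosable (k : nat) : Prop :=
  forall (C : choiceType) (L : edge G -> {fset C}),
    (forall f : edge G, k <= #|` L f|%fset) -> strong_edge_list_colorable L.

Definition is_list_strong_chromatic_index (k : nat) : Prop :=
  strong_edge_choosable k /\
  forall j : nat, strong_edge_choosable j -> k <= j.

End StrongColoring.

(* The Petersen graph as the Kneser graph K(5, 2). *)
Definition petersen_vertex : finType := {A : {set 'I_5} | #|A| == 2}.

Definition petersen_adj : rel petersen_vertex :=
  fun A B => [disjoint val A & val B].

Lemma petersen_adj_sym : symmetric petersen_adj.
Proof. by move=> A B; rewrite /petersen_adj disjoint_sym. Qed.

Lemma petersen_adj_irr : irreflexive petersen_adj.
Proof.
move=> A; rewrite /petersen_adj -setI_eq0 setIid -cards_eq0.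
by rewrite (eqP (valP A)).
Qed.

Definition petersen : sgraph := SGraph petersen_adj_sym petersen_adj_irr.

(* Main.v *)
Require Import Defs.
From mathcomp Require Import all_boot finmap zify.

Set Implicit Arguments.
Unset Strict Implicit.
Unset Printing Implicit Defensive.

(** Two distinct edges of the Petersen graph are at distance at most 2 exactly
    when they miss different points: viewed in the Kneser model, an edge is a
    pair of disjoint 2-subsets of a 5-element set, and so misses exactly one
    point.  Each point is missed by three edges, hence a strong edge-coloring is
    a proper vertex coloring of the complete multipartite graph K_{3,3,3,3,3}
    ([petersen_edge_coordinates], [avoids_near_eq], [avoids_neq_near]), and the
    theorem is the case of five parts of Kierstead's formula
    ceil((4 m - 1) / 3) for the choice number of m parts of size three.

    Upper bound: for m <= 5, m parts of size three can be colored from lists of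
    size m + 2 ([three_parts_choosable], by induction on m).  If Hall's condition
    holds, all vertices get different colors.  Otherwise take a maximal set S of
    vertices violating it.  The vertices outside S can be given distinct colors
    foreign to the lists on S ([hall_or_small_pot]), so only S matters, and its
    lists use fewer than #|S| <= 3 m colors; give the vertices outside S copies
    of a list from S.  If some color lies in the three lists of one part, use it
    on that part and apply induction.  Otherwise a part has lists of total size
    at least 3 m + 6 within fewer than 3 m colors, so at least 7 colors appear
    in two of its lists, and some pair of its vertices shares at least 3 colors.
    Merge two vertices in each part, giving the merged vertex the common colors:
    in two of the parts choose a pair with 3 common colors, and let the choices
    as a whole be such that the merged vertices have distinct representatives.
    The merged and the unmerged vertices then satisfy Hall's condition together
    ([triple_free_coloring]).

    Lower bound: give the three vertices of each part the colors 0, ..., 8 whose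
    residue mod 3 is not 0, not 1, not 2 respectively.  No color suits a whole
    part, so each of the five parts needs two colors of its own, but there are
    only nine ([three_parts_residue_lists]). *)

(** * Hall's theorem and the reduction to few colors *)

Section Hall.
Variables T K : finType.
Implicit Types (L : T -> {set K}) (S A : {set T}).

Definition pot L S : {set K} := \bigcup_(x in S) L x.

Lemma mem_pot L S x : x \in S -> L x \subset pot L S.
Proof. by move=> xS; apply: bigcup_sup. Qed.

Lemma pot_sub L S (B : {set K}) :
  (forall x, x \in S -> L x \subset B) -> pot L S \subset B.
Proof. by move=> sub; apply/bigcupsP. Qed.

Definition hall_condition L A :=
  [forall S : {set T}, (S \subset A) ==> (#|S| <= #|pot L S|)].

Lemma hall_conditionP L A :
  reflect (forall S, S \subset A -> #|S| <= #|pot L S|) (hall_condition L A).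
Proof. by apply: (iffP forallP) => h S; apply/implyP/h. Qed.

Definition drop_color L x c : T -> {set K} :=
  fun y => if y == x then L x :\ c else L y.

(** Rado's step.  If deleting [a] and deleting [b] both destroy Hall's condition,
    with violators S1 and S2, then both contain [x], and submodularity of the
    number of available colors makes S1 :|: S2 or (S1 :&: S2) :\ x a violator
    for the original lists. *)
Lemma hall_drop L A x a b :
  a != b -> hall_condition L A ->
  hall_condition (drop_color L x a) A || hall_condition (drop_color L x b) A.
Proof.
move=> ab /hall_conditionP hallL.
have viol c : ~~ hall_condition (drop_color L x c) A ->
  exists S : {set T}, [/\ S \subset A, #|pot (drop_color L x c) S| < #|S| & x \in S].
  rewrite negb_forall => /existsP[S]; rewrite negb_imply -ltnNge => /andP[SA lt].
  exists S; split=> //; apply: contraLR lt => xS; rewrite -leqNgt.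
  apply: leq_trans (hallL S SA) _.
  apply/subset_leq_card/pot_sub => y yS.
  have -> : L y = drop_color L x c y.
    by rewrite /drop_color; case: eqP yS xS => // -> ->.
  exact: mem_pot.
apply/orP; case: (boolP (hall_condition (drop_color L x a) A)) => [|/viol]; first by left.
case=> S1 [S1A lt1 xS1]; right; apply/negPn/negP => /viol[S2 [S2A lt2 xS2]].
set X := pot _ S1 in lt1; set Y := pot _ S2 in lt2.
have hU := hallL (S1 :|: S2); have hI := hallL ((S1 :&: S2) :\ x).
have {}hU : #|S1 :|: S2| <= #|X :|: Y|.
  apply: leq_trans (hU _) _; first by rewrite subUset S1A.
  apply/subset_leq_card/pot_sub => y yS.
  have [->|yx] := eqVneq y x.
    apply/subsetP => c cL; rewrite inE; have [ca|ca] := eqVneq c a.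
      apply/orP; right; apply: (subsetP (mem_pot _ xS2)).
      by rewrite /drop_color eqxx !inE ca ab -ca.
    apply/orP; left; apply: (subsetP (mem_pot _ xS1)).
    by rewrite /drop_color eqxx !inE ca.
  have dE c : L y = drop_color L x c y by rewrite /drop_color (negPf yx).
  case/setUP: yS => yS.
    by apply: subset_trans (subsetUl _ _); rewrite (dE a); apply: mem_pot.
  by apply: subset_trans (subsetUr _ _); rewrite (dE b); apply: mem_pot.
have {}hI : #|(S1 :&: S2) :\ x| <= #|X :&: Y|.
  apply: leq_trans (hI _) _.
    by apply: subset_trans (subsetDl _ _) _; apply: subset_trans (subsetIl _ _) S1A.
  apply/subset_leq_card/pot_sub => y; rewrite !inE => /and3P[yx yS1 yS2].
  have dE c : L y = drop_color L x c y by rewrite /drop_color (negPf yx).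
  by rewrite subsetI {1}(dE a) {1}(dE b) !mem_pot.
have := cardsUI S1 S2; have := cardsUI X Y.
have := cardsD1 x (S1 :&: S2); rewrite inE xS1 xS2 /=.
lia.
Qed.

(** The lists can be shrunk by Rado's step until each is a single color; the
    condition on pairs then makes these colors distinct.  The color [k0] only
    supplies values outside [A]. *)
Theorem hall L A (k0 : K) : hall_condition L A ->
  exists f : T -> K, {in A, forall x, f x \in L x} /\ {in A &, injective f}.
Proof.
have [n] := ubnP (\sum_(x in A) #|L x|); elim: n L => // n IH L ltn hallL.
case: (boolP [exists x in A, 1 < #|L x|]) => [/exists_inP[x xA]|small].
  case/card_gt1P=> a [b [aL bL ab]].
  have drop c : c \in L x -> hall_condition (drop_color L x c) A ->
      exists f : T -> K, {in A, forall x, f x \in L x} /\ {in A &, injective f}.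
    move=> cL /IH[].
      move: ltn; rewrite ltnS; apply: leq_trans.
      rewrite !(bigD1 x xA) /= /drop_color eqxx [X in _ < X + _](cardsD1 c) cL.
      rewrite add1n addSn ltnS leq_add2l.
      by apply: leq_sum => y /andP[_ /negPf->].
    move=> f [fL finj]; exists f; split=> // y yA.
    have := fL y yA; rewrite /drop_color; case: eqP => // ->.
    by rewrite inE => /andP[].
  by case/orP: (hall_drop x ab hallL) => /drop; apply.
move/hall_conditionP: hallL => hallL.
have one x : x \in A -> #|L x| == 1.
  move=> xA; move: small; rewrite negb_exists => /forallP/(_ x).
  rewrite xA /= -leqNgt eqn_leq => -> /=.
  have := hallL [set x]; rewrite sub1set cards1 => /(_ xA).
  by rewrite /pot big_set1.
pose f x := odflt k0 [pick c in L x].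
have fE x : x \in A -> L x = [set f x].
  move=> /one/cards1P[c Lx]; rewrite Lx /f; case: pickP => [d|/(_ c)].
    by rewrite Lx inE => /eqP->.
  by rewrite Lx inE eqxx.
exists f; split=> [x xA|x y xA yA fxy]; first by rewrite fE // inE.
apply/eqP/negPn/negP => xy.
have := hallL [set x; y]; rewrite subUset !sub1set xA yA => /(_ isT).
by rewrite /pot bigcup_setU !big_set1 fE // fE // fxy setUid cards1 cards2 xy.
Qed.

(** For a maximal violator S, a set violating Hall's condition outside S, once
    the colors of S are removed, could be added to S.  So the vertices outside S
    can be colored without ever interfering with S. *)
Lemma hall_or_small_pot L (k0 : K) :
  hall_condition L setT \/
  exists S, #|pot L S| < #|S| /\
    exists f : T -> K,
      {in ~: S, forall x, f x \in L x :\: pot L S} /\ {in ~: S &, injective f}.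
Proof.
case: (boolP (hall_condition L setT)) => [|nhall]; [by left | right].
have : [exists S : {set T}, #|pot L S| < #|S|].
  move: nhall; rewrite negb_forall => /existsP[S].
  by rewrite subsetT /= -ltnNge => lt; apply/existsP; exists S.
case/existsP=> S0 /(maxset_exists (P := fun S => #|pot L S| < #|S|))[S /maxsetP[ltS maxS] _].
exists S; split=> //; apply: hall => //; apply/hall_conditionP => R RS.
case: (set_0Vmem R) => [->|[x xR]]; first by rewrite cards0.
have dis : [disjoint S & R] by rewrite disjoint_sym disjoints_subset.
rewrite leqNgt; apply/negP => ltR.
have xS : x \notin S by move/subsetP/(_ x xR): RS; rewrite inE.
have E : S :|: R = S.
  apply: maxS => /=; last exact: subsetUl.
  have := cardsUI S R; rewrite (disjoint_setI0 dis) cards0.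
  set Q := pot _ R in ltR.
  have : #|pot L (S :|: R)| <= #|pot L S :|: Q|.
    apply/subset_leq_card/pot_sub => y /setUP[yS|yR].
      by apply: subset_trans (subsetUl _ _); apply: mem_pot.
    apply/subsetP => c cL; rewrite inE.
    have [//|cS] := boolP (c \in pot L S).
    by apply: (subsetP (mem_pot _ yR)); rewrite inE cS.
  by case: (leq_card_setU (pot L S) Q) => + _; lia.
by move: xS; rewrite -E inE xR orbT.
Qed.

End Hall.

(** * Choosability of complete multipartite graphs with parts of size three *)

Definition part_coloring m (K : finType) (L : 'I_m * 'I_3 -> {set K}) f :=
  (forall x, f x \in L x) /\
  (forall x y : 'I_m * 'I_3, x.1 != y.1 -> f x != f y).

(** ** Few colors, and no color common to a whole part *)

Section TripleFree.
Variables (m : nat) (K : finType) (L : 'I_m * 'I_3 -> {set K}).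

(** The list of the vertex obtained by merging the two vertices of part [i] other
    than [j]. *)
Definition merged i j : {set K} := \bigcap_(j' | j' != j) L (i, j').

Hypotheses (m5 : m <= 5) (sizeL : forall x, m.+2 <= #|L x|).
Hypothesis small_pot : #|pot L setT| < 3 * m.
Hypothesis no_triple : forall i c, exists j, c \notin L (i, j).

Lemma merged_disjoint i j : merged i j :&: L (i, j) = set0.
Proof.
apply/setP => c; rewrite !inE; apply/negP => /andP[/bigcapP cM cL].
have [j'] := no_triple i c; have [->|jj] := eqVneq j' j; first by rewrite cL.
by rewrite cM.
Qed.

(** When no color lies in all three lists, the list sizes add up to the number of
    colors seen by the part plus the number of colors seen twice: here at least
    3 (m + 2) against at most 3 m - 1, a difference of 7. *)
Lemma card_doubled i : 7 <= #|\bigcup_j merged i j|.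
Proof.
pose a := L (i, @Ordinal 3 0 isT); pose b := L (i, @Ordinal 3 1 isT).
pose c := L (i, @Ordinal 3 2 isT).
have sub : (a :&: b) :|: ((a :|: b) :&: c) \subset \bigcup_j merged i j.
  apply/subsetP => k kD; apply/bigcupP.
  have mm j : (forall j', j' != j -> k \in L (i, j')) ->
    exists2 j, true & k \in merged i j.
    by exists j => //; apply/bigcapP.
  move: kD; rewrite !inE => /orP[/andP[ka kb]|/andP[/orP[ka|kb] kc]].
  - apply: (mm (@Ordinal 3 2 isT)) => -[[|[|[]]] //= lt _];
      by rewrite (bool_irrelevance lt isT).
  - apply: (mm (@Ordinal 3 1 isT)) => -[[|[|[|]]] //= lt _];
      by rewrite (bool_irrelevance lt isT).
  - apply: (mm (@Ordinal 3 0 isT)) => -[[|[|[|]]] //= lt _];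
      by rewrite (bool_irrelevance lt isT).
apply: leq_trans (subset_leq_card sub).
have tr : (a :&: b) :&: ((a :|: b) :&: c) = set0.
  apply/setP => k; rewrite !inE; apply/negP => /andP[/andP[ka kb] /andP[_ kc]].
  have [[[|[|[|//]]] lt]] := no_triple i k;
    by rewrite (bool_irrelevance lt isT) -?/a -?/b -?/c ?ka ?kb ?kc.
have U : #|(a :|: b) :|: c| <= #|pot L setT|.
  by apply: subset_leq_card; rewrite !subUset !mem_pot.
have := cardsUI a b; have := cardsUI (a :|: b) c.
have := cardsUI (a :&: b) ((a :|: b) :&: c); rewrite tr cards0.
have := sizeL (i, @Ordinal 3 0 isT); have := sizeL (i, @Ordinal 3 1 isT).
have := sizeL (i, @Ordinal 3 2 isT); rewrite -/a -/b -/c.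
lia.
Qed.

(** Seven doubled colors are distributed among three pairs. *)
Lemma large_merged i : exists j, 3 <= #|merged i j|.
Proof.
case: (boolP [exists j, 3 <= #|merged i j|]) => [/existsP //|].
rewrite negb_exists => /forallP small; exfalso.
have : #|\bigcup_j merged i j| <= \sum_(j < 3) #|merged i j|.
  apply: (big_rec2 (fun (A : {set K}) n => #|A| <= n)); first by rewrite cards0.
  move=> j n A _ le; apply: leq_trans (leq_card_setU _ _) _.
  by rewrite leq_add2l.
have : \sum_(j < 3) #|merged i j| <= \sum_(j < 3) 2.
  by apply: leq_sum => j _; rewrite leqNgt small.
rewrite sum_nat_const card_ord; have := card_doubled i; lia.
Qed.

Lemma inhabited_colors : 0 < m -> K.
Proof.
move=> m0; suff /card_gt0P/sigW[c _] : 0 < #|L (Ordinal m0, ord0)| by exact: c.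
exact: leq_trans (sizeL _).
Qed.

(** Distinct representatives [d i] are chosen first, and they dictate which pair
    is merged.  In parts 0 and 1 the representative is taken from a pair with
    3 common colors; there and elsewhere the number of admissible representatives
    of part [i] exceeds [i], which is enough for Hall's condition. *)
Lemma merging_choice (k0 : K) : exists (w : 'I_m -> 'I_3) (d : 'I_m -> K),
  [/\ injective d, forall i, d i \in merged i (w i)
    & forall i : 'I_m, i < 2 -> 3 <= #|merged i (w i)|].
Proof.
have [best bestP] := fin_all_exists large_merged.
pose E (i : 'I_m) :=
  if i < 2 then merged i (best i) else \bigcup_j merged i j.
have ltE (i : 'I_m) : i < #|E i|.
  rewrite /E; case: ifP => i2; first by apply: leq_trans (bestP i); rewrite ltnS ltnW.
  by have := card_doubled i; have := ltn_ord i; lia.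
have hallE : hall_condition E setT.
  apply/hall_conditionP => S _.
  case: (set_0Vmem S) => [->|[i0 i0S]]; first by rewrite cards0.
  (* A set of parts with last element i has at most i + 1 members. *)
  case: (arg_maxnP (fun i : 'I_m => i : nat) i0S) => i iS maxi.
  apply: leq_trans (subset_leq_card (mem_pot E iS)); apply: leq_trans (ltE i).
  have -> : i.+1 = #|'I_i.+1| by rewrite card_ord.
  have inj : {in S &, injective (fun k : 'I_m => inord k : 'I_i.+1)}.
    move=> x y xS yS /(congr1 val); rewrite /= !inordK ?ltnS; try exact: maxi.
    exact: val_inj.
  by rewrite -(card_in_imset inj) max_card.
have [d [dE dinj]] := hall k0 hallE.
have /fin_all_exists[w wP] (i : 'I_m) : exists j : 'I_3,
    d i \in merged i j /\ (i < 2 -> 3 <= #|merged i j|).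
  have := dE i (in_setT i); rewrite /E.
  case: ifP => _; first by exists (best i).
  by case/bigcupP=> j _ dj; exists j.
exists w, d; split=> [x y||]; [exact: dinj | by move=> i; case: (wP i) ..].
Qed.

(** Hall's condition for the graph with vertices [(i, true)], merged, and
    [(i, false)], unmerged.  Let X be the set of parts contained in S, so that
    #|S| <= m + #|X|.  The two lists of a part are disjoint, so a part of X
    contributes m + 2 colors plus the size of its merged list.  This suffices if
    #|X| <= 3, as merged lists are nonempty; if #|X| is 4 or 5, then X contains
    part 0 or part 1, whose merged list has size 3.  If X is empty, either S
    has an unmerged vertex, with m + 2 colors, or the representatives of the
    merged vertices are available. *)
Lemma triple_free_coloring : exists f, part_coloring L f.
Proof.
have m0 : 0 < m by lia.
have k0 : K by exact: inhabited_colors m0.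
have [w [d [dinj dM big]]] := merging_choice k0.
pose H (v : 'I_m * bool) := if v.2 then merged v.1 (w v.1) else L (v.1, w v.1).
have hallH : hall_condition H setT.
  apply/hall_conditionP => S _.
  pose X := [set i | ((i, true) \in S) && ((i, false) \in S)].
  have cardS : #|S| <= m + #|X|.
    pose St := [set i | (i, true) \in S]; pose Sf := [set i | (i, false) \in S].
    have -> : X = St :&: Sf by apply/setP => i; rewrite !inE.
    have : #|S| <= #|St| + #|Sf|.
      have -> : S = [set (i, true) | i in St] :|: [set (i, false) | i in Sf].
        apply/setP => -[i t]; rewrite !inE; apply/idP/orP => [iS|].
          case: t iS => iS; [left | right]; by apply/imsetP; exists i; rewrite ?inE.
        by case=> /imsetP[i' + [-> ->]]; rewrite inE.
      by apply: leq_trans (leq_card_setU _ _) _; apply: leq_add; apply: leq_imset_card.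
    have := cardsUI St Sf; have := max_card (St :|: Sf); rewrite card_ord; lia.
  have full i : i \in X -> m.+2 + #|merged i (w i)| <= #|pot H S|.
    rewrite inE => /andP[it if_].
    have := cardsUI (merged i (w i)) (L (i, w i)); rewrite merged_disjoint cards0.
    have : #|merged i (w i) :|: L (i, w i)| <= #|pot H S|.
      by apply: subset_leq_card; rewrite subUset (mem_pot H it) (mem_pot H if_).
    have := sizeL (i, w i); lia.
  have [X3|X3] := leqP #|X| 3.
    case: (set_0Vmem X) => [X0|[i iX]].
      rewrite X0 cards0 in cardS.
      case: (boolP [exists i, (i, false) \in S]) => [/existsP[i iS]|].
        have : m.+2 <= #|pot H S|.
          exact: leq_trans (sizeL _) (subset_leq_card (mem_pot H iS)).
        lia.
      rewrite negb_exists => /forallP notf.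
      have inj : {in S &, injective (fun v => d v.1)}.
        move=> [x s] [y t] xS yS /= /dinj E; rewrite -{}E in yS *.
        by case: s t xS yS => -[] //; rewrite ?(negPf (notf x)).
      rewrite -(card_in_imset inj); apply/subset_leq_card/subsetP => c.
      case/imsetP=> -[i [|]] iS ->; last by rewrite (negPf (notf i)) in iS.
      by apply: (subsetP (mem_pot H iS)); apply: dM.
    have := full i iX; have : 0 < #|merged i (w i)| by apply/card_gt0P; exists (d i).
    lia.
  have [i iX i2] : exists2 i : 'I_m, i \in X & i < 2.
    case: (boolP [exists i in X, (i : nat) < 2]) => [/exists_inP //|].
    rewrite negb_exists_in => /forall_inP late; exfalso.
    pose shift (k : 'I_m) : 'I_3 := inord (k - 2).
    have inj : {in X &, injective shift}.
      move=> x y xX yX /(congr1 val).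
      have := late x xX; have := late y yX; rewrite -!leqNgt => hy hx.
      have := ltn_ord x; have := ltn_ord y => ly lx.
      rewrite /= !inordK; try lia; move=> E; apply: val_inj => /=; lia.
    have := max_card (shift @: X).
    by rewrite (card_in_imset inj) card_ord; lia.
  have := max_card X; rewrite card_ord => Xm.
  have := full i iX; have := big i i2; lia.
have [h [hH hinj]] := hall k0 hallH.
exists (fun x => h (x.1, x.2 != w x.1)); split=> [[i j]|x y xy].
  have := hH (i, j != w i) (in_setT _); rewrite /H /=.
  by have [->|jw] := eqVneq j (w i) => // /bigcapP; apply.
by apply: contraNneq xy => /hinj; rewrite !inE => /(_ isT isT) [->].
Qed.

End TripleFree.

(** ** The general case *)

(** Spending a color common to the three lists of a part removes that part and
    costs every other list at most one color, which is what m + 2 loses when m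
    decreases by 1; this is the inductive step. *)
Theorem three_parts_choosable m (K : finType) (L : 'I_m * 'I_3 -> {set K}) :
  m <= 5 -> (forall x, m.+2 <= #|L x|) -> exists f, part_coloring L f.
Proof.
elim: m K L => [|m IH] K L m5 sizeL.
  have noI (x : 'I_0 * 'I_3) : K by case: x => -[].
  by exists noI; split=> -[[]].
have k0 : K by exact: (inhabited_colors sizeL isT).
have [hallL|[S [ltS [f [fL finj]]]]] := hall_or_small_pot L k0.
  have [f [fL finj]] := hall k0 hallL.
  exists f; split=> [x|x y]; first exact: fL.
  by apply: contraNneq => /finj; rewrite !inE => /(_ isT isT) ->.
have [x0 x0S] : exists x, x \in S by apply/card_gt0P; apply: leq_ltn_trans ltS.
(* Outside S the new lists are dummies: a coloring from them is used on S only. *)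
pose L' x := if x \in S then L x else L x0.
have sizeL' x : m.+3 <= #|L' x| by rewrite /L'; case: ifP.
have potL' : #|pot L' setT| < 3 * m.+1.
  apply: leq_trans (_ : #|S| <= _); last first.
    by have := max_card S; rewrite card_prod !card_ord mulnC.
  apply: leq_ltn_trans ltS; apply/subset_leq_card/pot_sub => x _.
  by rewrite /L'; case: ifP => [xS|_]; apply: mem_pot.
have [g [gL gP]] : exists g, part_coloring L' g.
  case: (boolP [exists i, exists c, [forall j, c \in L' (i, j)]]); last first.
    move=> no; apply: triple_free_coloring => // i c; apply/existsP.
    apply: contraNT no; rewrite negb_exists => /forallP all.
    apply/existsP; exists i; apply/existsP; exists c; apply/forallP => j.
    by have := all j; rewrite negbK.
  case/existsP=> i /existsP[c /forallP ci].
  have [||h [hL hP]] := IH K (fun x => L' (lift i x.1, x.2) :\ c); first by lia.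
    move=> x; have := sizeL' (lift i x.1, x.2); rewrite (cardsD1 c); lia.
  exists (fun x => if unlift i x.1 is Some k then h (k, x.2) else c).
  split=> [[k j]|[k j] [k' j']] /=.
    case: unliftP => [l ->|->] //; have := hL (l, j); by rewrite inE => /andP[].
  case: unliftP => [l ->|->]; case: unliftP => [l' ->|->] /=.
  - by move=> ll; apply: hP; apply: contraNneq ll => /= ->.
  - by have := hL (l, j); rewrite !inE => /andP[].
  - by have := hL (l', j'); rewrite !inE eq_sym => /andP[].
  - by rewrite eqxx.
have gS x : x \in S -> g x \in L x by move=> xS; have := gL x; rewrite /L' xS.
exists (fun x => if x \in S then g x else f x).
have fS x : x \notin S -> (f x \in L x) && (f x \notin pot L S).
  by move=> xS; have := fL x; rewrite !inE andbC => ->.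
have gpot x : x \in S -> g x \in pot L S.
  by move=> xS; apply: (subsetP (mem_pot L xS)); apply: gS.
split=> [x|x y xy]; first by case: ifPn => [/gS|/fS/andP[]].
case: ifPn => xS; case: ifPn => yS.
- exact: gP.
- by case/andP: (fS y yS) => _; apply: contraNneq => <-; apply: gpot.
- by case/andP: (fS x xS) => _; apply: contraNneq => ->; apply: gpot.
- by apply: contraNneq xy => /finj -> //; rewrite inE.
Qed.

(** Pigeonhole: part [i] uses the color of its vertex 0 and, by the choice of
    [r i], a different one at the vertex whose list excludes the residue of that
    color.  This gives ten pairs (part, color slot) for nine colors. *)
Lemma three_parts_residue_lists (phi : 'I_5 * 'I_3 -> 'I_9) :
  (forall x, phi x %% 3 != x.2) ->
  exists x y : 'I_5 * 'I_3, x.1 != y.1 /\ phi x = phi y.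
Proof.
move=> phiL.
pose r i : 'I_3 := inord (phi (i, ord0) %% 3).
pose h (v : 'I_5 * bool) := phi (v.1, if v.2 then ord0 else r v.1).
have : ~~ injectiveb h.
  apply/negP => /injectiveP/leq_card.
  by rewrite card_prod !card_ord card_bool.
case/injectivePn=> -[i s] [[k t] ne E].
exists (i, if s then ord0 else r i), (k, if t then ord0 else r k); split=> //=.
apply: contraNneq ne => ik; rewrite -{}ik /h /= in E *.
have neq : phi (i, ord0) != phi (i, r i).
  have := phiL (i, r i); rewrite /= {2}/r inordK ?ltn_mod //.
  by apply: contraNneq => <-.
by case: s t E neq => -[] //= ->; rewrite eqxx.
Qed.

(** * Edges of the Petersen graph *)

Section Petersen.
Local Notation vtx := petersen_vertex.
Local Notation pedge := (edge petersen).
Implicit Types (i : 'I_5) (A B : vtx) (e f g : pedge).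

(** As the two ends of an edge cover four of the five points, each edge avoids
    exactly one point [i]; the part of an edge is this point. *)
Definition avoids e i := [forall A : vtx, (A \in val e) ==> (i \notin val A)].

Lemma avoidsP e i A : avoids e i -> A \in val e -> i \notin val A.
Proof. by move=> /forallP/(_ A)/implyP. Qed.

Lemma edge_ends e : exists A B : vtx, val e = [set A; B] /\ petersen_adj A B.
Proof. by have /imsetP[[A B] + ->] := valP e; rewrite inE; exists A, B. Qed.

Lemma edge_ends_adj e A B :
  A \in val e -> B \in val e -> A != B -> petersen_adj A B.
Proof.
have [C [D [-> CD]]] := edge_ends e.
rewrite !inE => /orP[]/eqP-> /orP[]/eqP->; rewrite ?eqxx // => _.
by rewrite petersen_adj_sym.
Qed.

Lemma adj_edge A B : petersen_adj A B -> exists e, val e = [set A; B].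
Proof.
move=> AB; have AB_edge : [set A; B] \in edge_set petersen.
  by apply/imsetP; exists (A, B); rewrite // inE.
by exists (Sub [set A; B] AB_edge); rewrite SubK.
Qed.

(** Disjoint pairs missing [i] are complementary in the four other points. *)
Lemma adj_complement i A B :
  petersen_adj A B -> i \notin val A -> i \notin val B -> val B = ~: (i |: val A).
Proof.
move=> AB iA iB; apply/eqP; rewrite eqEcard; apply/andP; split.
  apply/subsetP => x xB; rewrite !inE negb_or; apply/andP; split.
    by apply: contraNneq iB => <-.
  by rewrite (disjointFl AB xB).
have := cardsC (i |: val A).
rewrite cardsU1 iA (eqP (valP A)) (eqP (valP B)) card_ord.
by rewrite -[5]/(3 + 2) => /addnI->.
Qed.

Lemma edge_other_end e i A : avoids e i -> A \in val e ->
  exists2 B : vtx, val e = [set A; B] & val B = ~: (i |: val A).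
Proof.
move=> ei Ae; have [C [D [E CD]]] := edge_ends e.
have [B EB AB] : exists2 B : vtx, val e = [set A; B] & petersen_adj A B.
  move: Ae; rewrite E !inE => /orP[]/eqP->; first by exists D.
  by exists C; [rewrite setUC | rewrite petersen_adj_sym].
exists B => //; apply: adj_complement AB (avoidsP ei Ae) (avoidsP ei _).
by rewrite EB !inE eqxx orbT.
Qed.

Lemma avoids_covers e i k : avoids e i -> i != k ->
  exists2 A : vtx, A \in val e & k \in val A.
Proof.
move=> ei ik; have [A [D [E _]]] := edge_ends e.
have Ae : A \in val e by rewrite E !inE eqxx.
have [B EB cB] := edge_other_end ei Ae.
have [kA|kA] := boolP (k \in val A); first by exists A.
by exists B; rewrite ?EB ?cB !inE ?eqxx ?orbT // negb_or eq_sym ik.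
Qed.

Lemma edge_determined e f i A :
  avoids e i -> avoids f i -> A \in val e -> A \in val f -> e = f.
Proof.
move=> ei fi Ae Af; apply: val_inj.
have [B -> EB] := edge_other_end ei Ae; have [C -> EC] := edge_other_end fi Af.
by congr [set _; _]; apply: val_inj; rewrite EB EC.
Qed.

Lemma edge_adjP e f : reflect
  (e <> f /\ exists A : vtx, A \in val e /\ A \in val f) (edge_adj e f).
Proof.
apply: (iffP andP) => [[/eqP ne /set0Pn[A]]|[/eqP ne [A [Ae Af]]]].
  by rewrite inE => /andP AP; split=> //; exists A.
by split=> //; apply/set0Pn; exists A; rewrite inE Ae.
Qed.

(** Two edges missing the same point that share an end coincide, because the other
    end is determined.  If they are joined by an edge AB, then B is also the other
    end of the edge containing A, so they share an end again. *)
Lemma avoids_near_eq e f i d : avoids e i -> avoids f i ->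
  @is_dist (line_graph petersen) e f d -> d <= 2 -> e = f.
Proof.
move=> ei fi [[p [ep pf <-]] _].
case: p ep pf => [|h [|h' [|//]]] //=.
  rewrite andbT => /edge_adjP[_ [A [Ae Ah]]] E _; rewrite -{}E in fi *.
  exact: edge_determined ei fi Ae Ah.
case/and3P=> /edge_adjP[_ [A [Ae Ah]]] /edge_adjP[_ [B [Bh Bf]]] _.
move=> E _; rewrite {}E in Bf.
have [AB|AB] := eqVneq A B.
  by rewrite -AB in Bf; apply: edge_determined ei fi Ae Bf.
apply: (edge_determined ei fi _ Bf).
have [C -> EC] := edge_other_end ei Ae; rewrite !inE; apply/orP; right.
apply/eqP/val_inj; rewrite EC.
exact: adj_complement (edge_ends_adj Ah Bh AB) (avoidsP ei Ae) (avoidsP fi Bf).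
Qed.

(** Let A = {k, a} be the end of [e] containing the point [k] missed by [f].  One of
    the two disjoint ends of [f] does not contain [a]; nor does it contain [k], so
    it is adjacent to A, and the connecting edge is a middle step of a walk from
    [e] to [f]. *)
Lemma avoids_neq_near e f i k : avoids e i -> avoids f k -> i != k ->
  exists2 d, @is_dist (line_graph petersen) e f d & d <= 2.
Proof.
move=> ei fk ik; have [A Ae kA] := avoids_covers ei ik.
have ef : e <> f by move=> E; have := avoidsP fk (A := A); rewrite -E kA => /(_ Ae).
have walk0 : ~ @walk (line_graph petersen) e f 0.
  by case=> p [_ + /size0nil E]; rewrite E.
have [adjef|nadj] := boolP (edge_adj e f).
  exists 1 => //; split; last by case.
  by exists [:: f]; split=> //=; rewrite adjef.
have nshare B : B \in val e -> B \notin val f.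
  by move=> Be; apply: contra nadj => Bf; apply/edge_adjP; split=> //; exists B.
have walk1 : ~ @walk (line_graph petersen) e f 1.
  case=> -[|h [|h' p]] [] //=; rewrite andbT => eh E _.
  by rewrite -E eh in nadj.
exists 2 => //; split; last by case=> [|[|n]].
have [a Aa] : exists a, val A = [set k; a].
  have /cards2P[x [y [xy E]]] := valP A; move: kA; rewrite E !inE.
  by case/orP=> /eqP->; [exists y | exists x; rewrite setUC].
have [D Df aD] : exists2 D : vtx, D \in val f & a \notin val D.
  have [C [D [E CD]]] := edge_ends f.
  have [aC|aC] := boolP (a \in val C).
    by exists D; rewrite ?E ?inE ?eqxx ?orbT // (disjointFr CD aC).
  by exists C; rewrite ?E ?inE ?eqxx.
have AD : petersen_adj A D.
  rewrite /petersen_adj Aa disjoints_subset subUset !sub1set !inE aD andbT.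
  exact: avoidsP fk Df.
have [h hE] := adj_edge AD.
have Ah : A \in val h by rewrite hE !inE eqxx.
have Dh : D \in val h by rewrite hE !inE eqxx orbT.
exists [:: h; f]; split=> //=; rewrite andbT; apply/andP; split; apply/edge_adjP.
  split; last by exists A.
  by move=> E; have := nshare D; rewrite E Dh Df => /(_ isT).
split; last by exists D.
by move=> E; have := nshare A Ae; rewrite -E Ah.
Qed.

(** Among the four points other than i, call p the first one, [lift i ord0].  The
    edges missing i correspond to the three possible partners of p in the end
    that contains it. *)
Theorem petersen_edge_coordinates :
  exists q : 'I_5 * 'I_3 -> pedge,
    bijective q /\ forall x, avoids (q x) x.1.
Proof.
pose As (x : 'I_5 * 'I_3) : {set 'I_5} :=
  [set lift x.1 ord0; lift x.1 (lift ord0 x.2)].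
have As2 x : #|As x| == 2.
  by rewrite cards2 (inj_eq (@lift_inj _ _)) neq_lift.
have xAs x : x.1 \notin As x by rewrite !inE negb_or !neq_lift.
pose A x : vtx := Sub (As x) (As2 x).
have valA x : val (A x) = As x by rewrite SubK.
have edgeA x : exists e, avoids e x.1 /\ A x \in val e.
  have B2 : #|~: (x.1 |: As x)| == 2.
    have := cardsC (x.1 |: As x); rewrite cardsU1 xAs (eqP (As2 x)) card_ord.
    by move/eqP; rewrite -[5]/(3 + 2) eqn_add2l.
  pose B : vtx := Sub (~: (x.1 |: As x)) B2.
  have AB : petersen_adj (A x) B.
    by rewrite /petersen_adj valA SubK disjoints_subset setCK subsetUr.
  have [e eE] := adj_edge AB; exists e; rewrite eE !inE eqxx; split=> //.
  apply/forallP => C; apply/implyP; rewrite eE !inE => /orP[]/eqP->.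
    by rewrite valA.
  by rewrite SubK !inE eqxx.
have [q qP] := fin_all_exists edgeA.
exists q; split; last by move=> x; case: (qP x).
have qinj : injective q.
  move=> [i j] [i' j'] E; have [ai Ai] := qP (i, j); have [ai' Ai'] := qP (i', j').
  rewrite -{}E /= in ai' Ai' ai Ai.
  have ii : i = i'.
    apply/eqP/negPn/negP => ne; have [C Ce kC] := avoids_covers ai ne.
    by have := avoidsP ai' Ce; rewrite kC.
  subst i'; congr pair.
  have common C : C \in val (q (i, j)) -> lift i ord0 \in val C -> C = A (i, j).
    move=> Ce lC; have [B E EB] := edge_other_end ai Ai.
    move: Ce; rewrite E !inE => /orP[]/eqP // CB.
    by move: lC; rewrite CB EB valA !inE eqxx orbT.
  have /(congr1 val) : A (i, j') = A (i, j).
    by apply: common => //; rewrite valA !inE eqxx.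
  rewrite !valA => /setP/(_ (lift i (lift ord0 j))).
  rewrite !inE !(inj_eq (@lift_inj _ _)) eqxx orbT.
  by rewrite eq_sym (negPf (neq_lift _ _)) /= => /eqP.
have surj e : exists x, q x == e.
  have [C [D [E CD]]] := edge_ends e.
  have [i ei] : exists i, avoids e i.
    have : 0 < #|~: (val C :|: val D)|.
      have := cardsC (val C :|: val D); have := leq_card_setU (val C) (val D).
      by rewrite (eqP (valP C)) (eqP (valP D)) card_ord => -[+ _]; lia.
    case/card_gt0P=> i; rewrite !inE negb_or => /andP[iC iD]; exists i.
    by apply/forallP => F; apply/implyP; rewrite E !inE => /orP[]/eqP->.
  have [F Fe lF] := avoids_covers ei (neq_lift i (ord0 : 'I_4)).
  have [b Fb] : exists b, val F = [set lift i ord0; b] /\ lift i ord0 != b.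
    have /cards2P[x [y [xy EF]]] := valP F; move: lF; rewrite EF !inE.
    by case/orP=> /eqP->; [exists y | exists x; rewrite setUC eq_sym].
  case: Fb => Fb lb.
  have := avoidsP ei Fe; rewrite Fb !inE negb_or => /andP[_].
  case/unlift_some=> k bk _.
  have : ord0 != k by apply: contraNneq lb => ->; rewrite bk.
  case/unlift_some=> j kj _; exists (i, j); apply/eqP.
  have [aq Aq] := qP (i, j); apply: (edge_determined aq ei Aq).
  suff -> : A (i, j) = F by [].
  by apply: val_inj; rewrite valA Fb /As /= bk kj.
have [r rP] := fin_all_exists surj.
exists r => x; last exact/eqP.
by apply: qinj; apply/eqP.
Qed.

End Petersen.

(** * The list strong chromatic index *)

(** The finitely many lists live in a finite type of colors, embedded in [C] by
    [v]. *)
Lemma finite_pot (T : finType) (C : choiceType) (L : T -> {fset C}) :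
  exists (K : finType) (v : K -> C) (L' : T -> {set K}), injective v /\ forall x,
    #|L' x| = #|` L x|%fset /\ forall c, c \in L' x -> v c \in L x.
Proof.
pose U := (\big[fsetU/fset0]_x L x)%fset.
exists U, val, (fun x => fsub U (L x)); split=> [|x]; first exact: val_inj.
by split=> [|c]; [rewrite card_fsub // /U bigfcup_sup | rewrite in_fsub].
Qed.

Theorem petersen_7_choosable : strong_edge_choosable petersen 7.
Proof.
move=> C L sizeL; have [q [[r qK rK] qP]] := petersen_edge_coordinates.
have [K [v [L' [vinj L'P]]]] := finite_pot (L \o q).
have [|f [fL fP]] := three_parts_choosable (L := L') (leqnn 5).
  by move=> x; rewrite (L'P x).1 /=.
exists (v \o f \o r); split=> [e f' d ne dist d2 /vinj E|e]; last first.
  by have := (L'P (r e)).2 _ (fL (r e)); rewrite /= rK.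
have [same|diff] := eqVneq (r e).1 (r f').1; last first.
  by have := fP _ _ diff; rewrite E eqxx.
apply: ne; have ae := qP (r e); have af := qP (r f').
by rewrite -same in af; rewrite !rK in ae af; apply: (avoids_near_eq ae af dist d2).
Qed.

Theorem petersen_choosable_gt6 j :
  strong_edge_choosable petersen j -> 6 < j.
Proof.
move=> choosable; rewrite ltnNge; apply/negP => j6.
have [q [[r qK rK] qP]] := petersen_edge_coordinates.
pose L (e : edge petersen) :=
  [fset c in [set c : 'I_9 | c %% 3 != (r e).2]]%fset.
have sizeL e : j <= #|` L e|%fset.
  apply: leq_trans j6 _; rewrite card_finset cardsE -sum1_card big_mkcond /=.
  rewrite !big_ord_recl big_ord0 /=.
  by case: (r e).2 => -[|[|[|//]]].
have [phi [strong phiL]] := choosable _ L sizeL.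
have [|x [y [xy E]]] := three_parts_residue_lists (phi := phi \o q).
  by move=> x; have := phiL (q x); rewrite !inE qK.
have [d dist d2] := avoids_neq_near (qP x) (qP y) xy.
apply: (strong _ _ d _ dist d2 E) => /(can_inj qK) exy.
by rewrite exy eqxx in xy.
Qed.

Theorem theorem1p7 : is_list_strong_chromatic_index petersen 7.
Proof. by split=> [|j]; [exact: petersen_7_choosable | exact: petersen_choosable_gt6]. Qed.
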